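(* Let $m$ be a positive integer. Then $P(3m+2,2m+1)=3m+4$.
   Context: A binary sequence $s=s_0\cdots s_{N-1}$ is an $(n,d)$-robust positioning sequence if for all $0\le i<j\le N-n$ the Hamming distance between $s_i\cdots s_{i+n-1}$ and $s_j\cdots s_{j+n-1}$ is at least $d$. $P(n,d)$ denotes the maximum length $N$ of a binary $(n,d)$-robust positioning sequence. *)

(* Defs.v *)
From mathcomp Require Import all_boot.

Set Implicit Arguments.
Unset Strict Implicit.
Unset Printing Implicit Defensive.

(* Only meaningful for words of the same size, since [zip] truncates. *)
Definition hamming (u v : seq bool) : nat :=
  count (fun p => p.1 != p.2) (zip u v).

Definition window (n i : nat) (s : seq bool) : seq bool := take n (drop i s).

(* [j + n <= size s] is [j <= N - n] without truncated subtraction; in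
   particular the condition is vacuous when [size s <= n]. *)
Definition robust_positioning (n d : nat) (s : seq bool) : Prop :=
  forall i j : nat, i < j -> j + n <= size s ->
    d <= hamming (window n i s) (window n j s).

(* [is_P n d N] states that the maximum P(n, d) exists and equals [N].
   A predicate is used because the maximum need not exist: for [d = 0] every
   sequence is robust. *)
Definition is_P (n d N : nat) : Prop :=
  (exists2 s : seq bool, robust_positioning n d s & size s = N) /\
  (forall s : seq bool, robust_positioning n d s -> size s <= N).

(* Main.v *)
(** Four words of length [3m+2] at pairwise distance at least [2m+1] would be
    given by the windows of a sequence of length [3m+5]. The three distances
    between any three binary words sum to twice the number of columns where
    they are not all equal; this sum is even, at least [6m+3], and at most
    [2(3m+2) = 6m+4], so no column has three equal entries. Hence four
    consecutive bits of the sequence are always balanced, and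
    [s_k xor s_(k+2)] does not depend on [k]. If it is 0, the windows at 0 and
    2 coincide; if it is 1, they are at distance [3m+2], which leaves only
    [3m+2 < 2(2m+1)] for the distances 0-1 and 1-2. The bound is attained by
    010010010... *)

Require Import Defs.
From mathcomp Require Import all_boot.
From mathcomp Require Import zify.

Lemma hamming_windowE (n i j : nat) (s : seq bool) :
  i + n <= size s -> j + n <= size s ->
  hamming (window n i s) (window n j s) =
  count (fun k => nth false s (i + k) != nth false s (j + k)) (iota 0 n).
Proof.
have windowE l : l + n <= size s ->
    window n l s = [seq nth false s (l + k) | k <- iota 0 n].
  move=> hl; apply: (@eq_from_nth _ false) => [|k].
    rewrite size_map size_iota size_takel // size_drop; lia.
  rewrite size_takel ?size_drop; last by lia.
  move=> hk; rewrite (nth_map 0) ?size_iota // nth_iota // add0n.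
  by rewrite nth_take // nth_drop.
by move=> hi hj; rewrite /hamming !windowE // zip_map count_map.
Qed.

Lemma count_iota_periodic (p : pred nat) (q m r : nat) :
  (forall k, p (q + k) = p k) ->
  count p (iota 0 (q * m + r)) = m * count p (iota 0 q) + count p (iota 0 r).
Proof.
move=> per; elim: m => [|m IHm]; first by rewrite muln0.
rewrite mulnS -addnA iotaD count_cat add0n -{2}[q]addn0 iotaDl count_map.
by rewrite (eq_count (a2 := p)) // IHm mulSn addnA.
Qed.

(** Two bits out of three always agree, so a non-constant column has exactly two disagreeing
    pairs. *)
Lemma sum_three_distances (T : Type) (u v w : T -> bool) (r : seq T) :
  count (fun k => u k != v k) r + count (fun k => v k != w k) r
    + count (fun k => u k != w k) r
  = 2 * count (fun k => ~~ ((u k == v k) && (v k == w k))) r.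
Proof.
elim: r => //= k r IHr.
by case: (u k) (v k) (w k) => [] [] [] /=; lia.
Qed.

Lemma no_constant_column (u v w : nat -> bool) (n d : nat) :
  2 * n <= 3 * d + 1 ->
  d <= count (fun k => u k != v k) (iota 0 n) ->
  d <= count (fun k => v k != w k) (iota 0 n) ->
  d <= count (fun k => u k != w k) (iota 0 n) ->
  forall k, k < n -> ~~ ((u k == v k) && (v k == w k)).
Proof.
move=> hnd huv hvw huw k hk.
have sumE := @sum_three_distances nat u v w (iota 0 n).
set g := fun k => ~~ (_ && _) in sumE *.
have /allP gP : all g (iota 0 n).
  rewrite all_count size_iota.
  have := count_size g (iota 0 n); rewrite size_iota; lia.
by apply: (gP k); rewrite mem_iota.
Qed.

(** Only shifts 0, 1 and 2 occur. For any two of them, each period of three columns gives two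
    mismatches, and the two remaining columns give at least one. *)
Lemma robust_positioning_witness (m : nat) :
  robust_positioning (3 * m + 2) (2 * m + 1)
    (mkseq (fun k => k %% 3 == 1) (3 * m + 4)).
Proof.
move=> i j ij; rewrite size_mkseq => hj.
rewrite hamming_windowE ?size_mkseq; [|lia..].
pose c l k := (l + k) %% 3 == 1.
rewrite (eq_in_count (a2 := fun k => c i k != c j k)); last first.
  by move=> k; rewrite mem_iota => hk; rewrite !nth_mkseq //; lia.
have per l k : c l (3 + k) = c l k by rewrite /c addnCA modnDl.
rewrite count_iota_periodic => [|k]; last by rewrite !per.
have : j <= 2 by lia.
by case: j ij {hj} => [|[|[|j]]] //; case: i => [|[|i]] // _ _;
  rewrite /c /=; lia.
Qed.

Lemma robust_positioning_size_le (m : nat) (s : seq bool) :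
  0 < m -> robust_positioning (3 * m + 2) (2 * m + 1) s ->
  size s <= 3 * m + 4.
Proof.
move=> m_gt0 rob; rewrite leqNgt; apply/negP => size_s.
set n := 3 * m + 2 in rob; pose f i k := nth false s (i + k).
have dist i j : i < j -> j <= 3 ->
    2 * m + 1 <= count (fun k => f i k != f j k) (iota 0 n).
  move=> ij j3; rewrite -hamming_windowE; [|lia..].
  by apply: rob => //; lia.
have ncol i j l k : i < j -> j < l -> l <= 3 -> k < n ->
    ~~ ((f i k == f j k) && (f j k == f l k)).
  move=> ij jl l3; apply: (@no_constant_column _ _ _ n (2 * m + 1));
    [lia | apply: dist; lia..].
have balanced k : k < n -> (f 0 k != f 2 k) = (f 1 k != f 3 k).
  move=> hk.
  have := (ncol 0 1 2 k isT isT isT hk, ncol 0 1 3 k isT isT isT hk,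
           ncol 0 2 3 k isT isT isT hk, ncol 1 2 3 k isT isT isT hk).
  by case: (f 0 k) (f 1 k) (f 2 k) (f 3 k) => [] [] [] [] [[[]]].
have f_succ i k : f i k.+1 = f i.+1 k by rewrite /f addnS.
have const k : k < n -> (f 0 k != f 2 k) = (f 0 0 != f 2 0).
  (* Rows 0 and 2 at column [k.+1] are rows 1 and 3 at column [k], so [balanced] leads back to
     column [k]. *)
  elim: k => // k IHk hk.
  by rewrite !f_succ -balanced ?IHk //; apply: ltnW.
have d02E : count (fun k => f 0 k != f 2 k) (iota 0 n) = (f 0 0 != f 2 0) * n.
  rewrite (eq_in_count (a2 := fun=> f 0 0 != f 2 0)) => [|k]; last first.
    by rewrite mem_iota => hk; apply: const.
  case: (_ != _); first by rewrite count_predT size_iota mul1n.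
  by rewrite count_pred0.
have := @sum_three_distances nat (f 0) (f 1) (f 2) (iota 0 n).
set g := fun k => ~~ (_ && _).
have := count_size g (iota 0 n); rewrite size_iota.
have := (dist 0 1 isT isT, dist 1 2 isT isT, dist 0 2 isT isT).
(* If the bits differ, [4 * m + 2 <= 3 * m + 2] contradicts [0 < m]; otherwise the distance 0-2
   vanishes. *)
rewrite d02E; case: (_ != _) => -[[]]; lia.
Qed.

Theorem theorem7p5 (m : nat) (hm : 0 < m) :
  is_P (3 * m + 2) (2 * m + 1) (3 * m + 4).
Proof.
split=> [|s]; last exact: robust_positioning_size_le.
exists (mkseq (fun k => k %% 3 == 1) (3 * m + 4)); last exact: size_mkseq.
exact: robust_positioning_witness.
Qed.
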